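(* Let $m\geq 1$ and let $\alpha\in\mathbb{R}$ be an algebraic number of degree $m$ over $\mathbb{Q}$. Then there exists a rational $m\times m$ absorbing game that is halting (strictly absorbing) and recursive and whose undiscounted value equals $\alpha$. If $\alpha>0$, then the game is moreover positive recursive.
   Context: An $m\times n$ (zero-sum) absorbing game is a tuple $\Gamma=(\mathcal I,\mathcal J,g,q,w)$, where $\mathcal I=\{1,\dots,m\}$ and $\mathcal J=\{1,\dots,n\}$ are the action sets of Player 1 (maximizer) and Player 2 (minimizer), and $g,w\colon\mathcal I\times\mathcal J\to\mathbb R$ and $q\colon\mathcal I\times\mathcal J\to[0,1]$ are the stage payoff, absorbing payoff and absorption probability functions (written $g_{ij},w_{ij},q_{ij}$; $w_{ij}$ is relevant only when $q_{ij}>0$). The game is rational if all $g_{ij},q_{ij},w_{ij}$ are rational; strictly absorbing (also called halting) if $q_{ij}>0$ for all $(i,j)$; recursive if $g_{ij}=0$ for all $(i,j)$; positive recursive if it is recursive and $w_{ij}>0$ whenever $q_{ij}>0$. Dynamics: at each stage $\ell=1,2,\dots$ at which no absorption has yet occurred, the players simultaneously and independently select actions $I_\ell\in\mathcal I$, $J_\ell\in\mathcal J$, the stage payoff is $G_\ell=g(I_\ell,J_\ell)$, and absorption occurs with probability $q(I_\ell,J_\ell)$. If absorption occurs at stage $\ell_0$, then $G_\ell=w(I_{\ell_0},J_{\ell_0})$ for all $\ell>\ell_0$. A (behavior) strategy of Player 1 (resp. Player 2) is a map from finite histories of action pairs (including the empty one) to $\Delta(\mathcal I)$ (resp. $\Delta(\mathcal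 J)$), where $\Delta(\cdot)$ denotes the set of probability distributions; $\Sigma$ and $\mathcal T$ denote the sets of strategies of Players 1 and 2. For $\lambda\in(0,1]$ the $\lambda$-discounted payoff is $\gamma_\lambda(\sigma,\tau)=\mathbb E_{\sigma,\tau}\bigl[\sum_{\ell\ge1}\lambda(1-\lambda)^{\ell-1}G_\ell\bigr]$, and $v_\lambda$ is the value of the game with this payoff. The long-run average payoff is $\gamma(\sigma,\tau)=\mathbb E_{\sigma,\tau}\bigl[\liminf_{L\to\infty}\frac1L\sum_{\ell=1}^LG_\ell\bigr]$. The undiscounted value is $v=\sup_{\sigma\in\Sigma}\inf_{\tau\in\mathcal T}\gamma(\sigma,\tau)=\inf_{\tau\in\mathcal T}\sup_{\sigma\in\Sigma}\gamma(\sigma,\tau)$; it is known (Kohlberg, Mertens–Neyman) that the two sides coincide and that $v=\lim_{\lambda\to0^+}v_\lambda$. A real number is algebraic of degree $m$ over $\mathbb Q$ if it is a root of a rational polynomial of degree $m$ and of no nonzero rational polynomial of smaller degree. *)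

(* Defs.v *)
From HB Require Import structures.
From mathcomp Require Import all_boot all_order all_algebra.
From mathcomp Require Import all_classical all_reals all_analysis.

Set Implicit Arguments.
Unset Strict Implicit.
Unset Printing Implicit Defensive.

Import Order.TTheory GRing.Theory Num.Theory.
Import numFieldNormedType.Exports.

Local Open Scope classical_set_scope.
Local Open Scope ring_scope.

Definition cylinder (Y : Type) (h : seq Y) : set (nat -> Y) :=
  [set w | mkseq w (size h) = h].

(* The points of a trajectory live in an option type because the library
   only puts sigma-algebras on pointed types. *)
Notation trajectory X :=
  (g_sigma_algebraType (range (@cylinder (option X)))).

Section trajectory_law.
Context (R : realType) (X : finType).
Local Notation Y := (option X).
Variable K : seq Y -> Y -> R.
Implicit Types (h p : seq Y) (x y : Y) (u : R).

(* Probability that a random trajectory starts with h, when the point that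
   follows a finite past p has law K p. *)
Definition traj_prob h : R :=
  \prod_(l < size h) K (take l h) (nth None h l).

Hypothesis K_ge0 : forall p x, 0 <= K p x.
Hypothesis K_sum1 : forall p, \sum_x K p x = 1.

(* Existence of the law: [0, 1[ is split into nested intervals indexed by the
   finite trajectories, the interval of h having length traj_prob h. *)

Let cum p k : R := \sum_(y <- take k (enum {: Y})) K p y.

Let lo h : R := \sum_(l < size h)
  traj_prob (take l h) * cum (take l h) (index (nth None h l) (enum {: Y})).

Let cell h u := lo h <= u < lo h + traj_prob h.

Let next h u : Y := odflt None [pick x | cell (rcons h x) u].

Let prefix_of u := fix prefix_of n : seq Y :=
  if n is n'.+1 then rcons (prefix_of n') (next (prefix_of n') u) else [::].

Let code u : trajectory X := fun n => next (prefix_of u n) u.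

Let traj_prob_rcons h x : traj_prob (rcons h x) = traj_prob h * K h x.
Proof.
rewrite /traj_prob size_rcons big_ord_recr /=; congr (_ * _).
  apply: eq_bigr => i _.
  by rewrite -cats1 takel_cat 1?ltnW// nth_cat ltn_ord.
by rewrite -cats1 take_size_cat// nth_cat ltnn subnn.
Qed.

Let lo_rcons h x :
  lo (rcons h x) = lo h + traj_prob h * cum h (index x (enum {: Y})).
Proof.
rewrite /lo size_rcons big_ord_recr /=; congr (_ + _).
  apply: eq_bigr => i _.
  by rewrite -cats1 takel_cat 1?ltnW// nth_cat ltn_ord.
by rewrite -cats1 take_size_cat// nth_cat ltnn subnn.
Qed.

Let traj_prob_ge0 h : 0 <= traj_prob h.
Proof. by apply: prodr_ge0. Qed.

Let cumS p k : (k < size (enum {: Y}))%N ->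
  cum p k.+1 = cum p k + K p (nth None (enum {: Y}) k).
Proof. by move=> kY; rewrite /cum (take_nth None)// big_rcons. Qed.

Let cum_le p : {homo cum p : i j / (i <= j)%N >-> i <= j}.
Proof.
move=> i j ij; rewrite /cum -(subnKC ij) takeD big_cat/= lerDl.
by apply: sumr_ge0.
Qed.

Let cum1 p k : cum p k <= 1.
Proof.
apply: (@le_trans _ _ (cum p (maxn k (size (enum {: Y}))))).
  by apply: cum_le; rewrite leq_maxl.
by rewrite /cum take_oversize ?leq_maxr// big_enum/= K_sum1.
Qed.

Let cellE h x u : cell (rcons h x) u =
  (lo h + traj_prob h * cum h (index x (enum {: Y})) <= u
     < lo h + traj_prob h * cum h (index x (enum {: Y})).+1).
Proof.
rewrite /cell lo_rcons traj_prob_rcons cumS ?index_mem ?mem_enum//.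
by rewrite nth_index ?mem_enum// mulrDr addrA.
Qed.

Let cell_sub h x u : cell (rcons h x) u -> cell h u.
Proof.
rewrite cellE /cell => /andP[lu uh]; apply/andP; split.
  apply: le_trans lu; rewrite lerDl mulr_ge0//.
  by rewrite /cum; apply: sumr_ge0.
by apply: (lt_le_trans uh); rewrite lerD2l ler_piMr.
Qed.

Let cell_inj h x y u : cell (rcons h x) u -> cell (rcons h y) u -> x = y.
Proof.
suff ge z t : cell (rcons h z) u -> cell (rcons h t) u ->
    (index z (enum {: Y}) <= index t (enum {: Y}))%N.
  move=> hx hy; apply: (index_inj x (s := enum {: Y})); rewrite ?mem_enum//.
  by apply/eqP; rewrite eqn_leq !ge.
rewrite !cellE => /andP[zu _] /andP[_ ut]; rewrite leqNgt; apply/negP => tz.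
have := le_lt_trans zu ut; rewrite ltrD2l ltNge => /negP; apply.
by apply: ler_wpM2l => //; exact: cum_le.
Qed.

Let cell_exists h u : cell h u -> exists x, cell (rcons h x) u.
Proof.
move=> /andP[hu uh].
pose F k := lo h + traj_prob h * cum h k.
have uF : u < F (size (enum {: Y})).
  by rewrite /F /cum take_size big_enum/= K_sum1 mulr1.
have [k uk kmin] := ex_minnP (ex_intro (fun k => u < F k) _ uF).
case: k uk kmin => [|k] uk kmin.
  by move: uk; rewrite /F /cum take0 big_nil mulr0 addr0 ltNge hu.
have kY : (k < size (enum {: Y}))%N by exact: kmin.
exists (nth None (enum {: Y}) k); rewrite cellE index_uniq ?enum_uniq//.
rewrite -/(F k) -/(F k.+1) uk andbT leNgt; apply/negP => /kmin.
by rewrite ltnn.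
Qed.

Let cell_next h x u : cell h u -> cell (rcons h x) u <-> next h u = x.
Proof.
move=> hu; rewrite /next; case: pickP => [y hy/=|noy].
  by split=> [|<-//]; exact: cell_inj.
by have [y] := cell_exists hu; rewrite noy.
Qed.

Let mkseq_code u n : mkseq (code u) n = prefix_of u n.
Proof.
by elim: n => //= n IH; rewrite mkseqS IH.
Qed.

Let prefix_cell u h : 0 <= u < 1 -> prefix_of u (size h) = h <-> cell h u.
Proof.
move=> u01; elim/last_ind: h => [|h x IH].
  by rewrite /cell /lo /traj_prob !big_ord0 add0r.
rewrite size_rcons/=; split.
  move=> /rcons_inj[hh]; rewrite hh => hx.
  by apply/(cell_next x (IH.1 hh)).
move=> hx; have hu := cell_sub hx; rewrite (IH.2 hu).
by rewrite ((cell_next x hu).1 hx).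
Qed.

Let unit_itv : set (measurableTypeR R) := `[0, 1[.

Let clip (u : measurableTypeR R) : R := if u \in unit_itv then u else 0.

Let traj_of (u : measurableTypeR R) : trajectory X := code (clip u).

Let clip01 u : 0 <= clip u < 1.
Proof.
rewrite /clip; case: ifPn; last by rewrite lexx ltr01.
by rewrite inE /unit_itv/= in_itv.
Qed.

Let traj_of_cylinder h :
  traj_of @^-1` cylinder h `&` unit_itv = `[lo h, lo h + traj_prob h[%classic.
Proof.
have cyl u : (traj_of @^-1` cylinder h) u <-> cell h (clip u).
  by rewrite -prefix_cell ?clip01// /cylinder/= mkseq_code.
have lo01 u : cell h u -> 0 <= u < 1.
  elim/last_ind: {cyl} h => [|h x IH]; last by move/cell_sub.
  by rewrite /cell /lo /traj_prob !big_ord0 add0r.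
apply/seteqP; split => u /=.
  by move=> [/cyl + uI]; rewrite /clip mem_set// in_itv.
rewrite in_itv/= => hu; have uI : unit_itv u by rewrite /unit_itv/= in_itv/= lo01.
by split=> //; apply/cyl; rewrite /clip mem_set.
Qed.

Let measurable_unit_itv : measurable unit_itv.
Proof. exact: measurable_itv. Qed.

Let measurable_traj_of : measurable_fun setT traj_of.
Proof.
apply: (@measurability _ _ _ _ setT traj_of (range (@cylinder Y)) erefl) => //.
move=> _ [_ [h _ <-] <-].
rewrite setTI -(setUIDK (traj_of @^-1` cylinder h) unit_itv).
apply: measurableU.
  by rewrite traj_of_cylinder; exact: measurable_itv.
have [hz|hz] := pselect (cylinder h (code 0)).
  have -> : traj_of @^-1` cylinder h `\` unit_itv = ~` unit_itv.
    apply/seteqP; split=> u /=; first by case.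
    by move=> uI; split=> //; rewrite /traj_of /clip memNset.
  exact: measurableC.
have -> : traj_of @^-1` cylinder h `\` unit_itv = set0; last by [].
by apply/seteqP; split=> u //= [+ uI]; rewrite /traj_of /clip memNset.
Qed.

Let mu := mrestr (@lebesgue_measure R) measurable_unit_itv.

Let mnormalize1 d (T : measurableType d) (nu : {measure set T -> \bar R})
    (P : probability T R) A :
  nu setT = 1%E -> mnormalize nu P A = nu A.
Proof.
move=> nuT; rewrite /mnormalize nuT.
by rewrite eqe oner_eq0/= invr1 mule1.
Qed.

Lemma trajectory_law_exists :
  exists P : probability (trajectory X) R,
    forall h, P (cylinder h) = (traj_prob h)%:E.
Proof.
have muT : mu setT = 1%E.
  by rewrite /mu/= /mrestr setTI /unit_itv lebesgue_measure_itv/= lte01 sube0.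
pose U : probability (measurableTypeR R) R := mnormalize mu \d_(0 : measurableTypeR R).
have UE A : U A = mu A by exact: mnormalize1.
pose f : {mfun measurableTypeR R >-> trajectory X} :=
  mfun_Sub (mem_set measurable_traj_of).
exists (distribution U f) => h.
rewrite /distribution /pushforward/= UE /mu/= /mrestr.
rewrite [X in lebesgue_measure X]traj_of_cylinder lebesgue_measure_itv/= lte_fin.
rewrite ltrDl; case: ltP => [_|]; first by rewrite -EFinB addrAC subrr add0r.
by move=> t0; congr EFin; apply/eqP; rewrite eq_le t0 traj_prob_ge0.
Qed.

End trajectory_law.

Record dist (R : realType) (T : finType) := Dist {
  pmf :> T -> R ;
  pmf_ge0 : forall t, 0 <= pmf t ;
  pmf_sum1 : \sum_t pmf t = 1 }.

Record absorbing_game (R : realType) (m n : nat) := AbsorbingGame {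
  stage_payoff : 'I_m * 'I_n -> R ;
  absorption_prob : 'I_m * 'I_n -> R ;
  absorbing_payoff : 'I_m * 'I_n -> R ;
  absorption_prob_itv : forall a, 0 <= absorption_prob a <= 1 }.

Section absorbing_games.
Context (R : realType) (m n : nat) (G : absorbing_game R m n).

Local Notation profile := ('I_m * 'I_n)%type.
Local Notation g := (stage_payoff G).
Local Notation q := (absorption_prob G).
Local Notation w := (absorbing_payoff G).

Definition rational_game := forall a,
  [/\ range ratr (g a), range ratr (q a) & range ratr (w a)].

Definition halting := forall a, 0 < q a.

Definition recursive := forall a, g a = 0.

Definition positive_recursive := recursive /\ forall a, 0 < q a -> 0 < w a.

Definition strategy1 := seq profile -> dist R 'I_m.
Definition strategy2 := seq profile -> dist R 'I_n.

(* What happens at a stage: Some (a, b) if the action profile a is played and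
   b tells whether absorption occurs, None if absorption occurred earlier. *)
Local Notation stage := (option (profile * bool)).

Definition played (h : seq stage) : seq profile := [seq s.1 | s <- pmap id h].

Definition absorbed_at (h : seq stage) : option profile :=
  ohead [seq s.1 | s <- pmap id h & s.2].

Definition stage_prob (sigma : strategy1) (tau : strategy2)
    (h : seq stage) (s : stage) : R :=
  match absorbed_at h, s with
  | None, Some (a, b) =>
      sigma (played h) a.1 * tau (played h) a.2 * (if b then q a else 1 - q a)
  | Some _, None => 1
  | _, _ => 0
  end.

Lemma stage_prob_ge0 sigma tau h s : 0 <= stage_prob sigma tau h s.
Proof.
rewrite /stage_prob; case: absorbed_at => [_|]; case: s => [[a b]|] //.
have /andP[q0 q1] := absorption_prob_itv G a.
by rewrite !mulr_ge0 ?pmf_ge0//; case: b; rewrite ?subr_ge0.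
Qed.

Lemma stage_prob_sum1 sigma tau h : \sum_s stage_prob sigma tau h s = 1.
Proof.
rewrite (bigD1 None)//= /stage_prob; case: absorbed_at => [_|].
  by rewrite big1 ?addr0// => -[].
rewrite add0r (reindex_omap Some id) => [|[]//].
under eq_bigl => t do rewrite /= eqxx.
pose p1 := sigma (played h); pose p2 := tau (played h).
transitivity (\sum_(a : profile) \sum_(b : bool)
    p1 a.1 * p2 a.2 * (if b then q a else 1 - q a)).
  by rewrite pair_bigA; apply: eq_bigr => -[].
transitivity (\sum_(i : 'I_m) \sum_(j : 'I_n) p1 i * p2 j).
  rewrite [RHS]pair_bigA; apply: eq_bigr => a _.
  by rewrite big_bool/= -mulrDr addrC subrK mulr1.
by rewrite -big_distrlr/= !pmf_sum1 mulr1.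
Qed.

Definition play_law sigma tau : probability (trajectory (profile * bool)) R :=
  sval (cid (trajectory_law_exists
    (stage_prob_ge0 sigma tau) (stage_prob_sum1 sigma tau))).

Lemma play_lawE sigma tau h :
  play_law sigma tau (cylinder h) = (traj_prob (stage_prob sigma tau) h)%:E.
Proof. by rewrite /play_law; case: cid. Qed.

(* Stages are numbered from 0. The last case has probability 0. *)
Definition payoff_at (l : nat) (omega : trajectory (profile * bool)) : R :=
  match absorbed_at (mkseq omega l), omega l with
  | Some a, _ => w a
  | None, Some (a, _) => g a
  | None, None => 0
  end.

Definition mean_payoff (L : nat) (omega : trajectory (profile * bool)) : R :=
  L%:R^-1 * \sum_(l < L) payoff_at l omega.

Definition average_payoff (sigma : strategy1) (tau : strategy2) : \bar R :=
  'E_(play_law sigma tau)[fun omega => limn_inf (mean_payoff ^~ omega)].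

Definition lower_value : \bar R :=
  ereal_sup [set ereal_inf [set average_payoff sigma tau | tau in setT]
            | sigma in setT].

Definition upper_value : \bar R :=
  ereal_inf [set ereal_sup [set average_payoff sigma tau | sigma in setT]
            | tau in setT].

Definition undiscounted_value_is (v : R) :=
  lower_value = v%:E /\ upper_value = v%:E.

End absorbing_games.

Definition algebraic_of_degree (R : realType) (x : R) (d : nat) :=
  (exists p : {poly rat}, size p = d.+1 /\ root (map_poly ratr p) x) /\
  forall p : {poly rat}, p != 0 -> (size p <= d)%N ->
    ~~ root (map_poly ratr p) x.

(* Main.v *)
Require Import Defs.
From mathcomp Require Import all_boot all_order all_algebra.
From mathcomp Require Import all_classical all_reals all_analysis.
From mathcomp Require Import measurable_realfun ring lra.

(* A halting recursive game with absorption probabilities q and absorbing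
   payoffs w has value alpha as soon as the matrix q_ij (w_ij - alpha), that is
   A - alpha B up to scaling with A = qw and B = q, has strictly positive left
   and right kernel vectors x and z: if one player plays x (or z) at every stage,
   then, whatever the other does, the terminal payoff minus alpha is a
   martingale started at 0, and absorption is almost sure.

   To find rational A and B with this property, start from the companion matrix
   M of a minimal polynomial p of alpha, with eigenvectors l M = alpha l and
   M y = alpha y. The entries of l are the Horner values of p at alpha, nonzero
   by minimality of the degree, and l y = p'(alpha) <> 0; hence a change of
   signs gives l > 0 and l y > 0. Now choose rational matrices P and Q whose
   rows are close to l and span simplicial cones with l in their interior, so
   that Q y > 0 and l = x P with x > 0, and put E = c Q^-1 with c > 0 chosen to
   clear denominators. Since l is interior to the cone of Q, l E > 0, hence
   B = P E > 0 if P is close enough to l; likewise A = P M E > 0 if alpha > 0,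
   as l M E = alpha l E. Finally x (A - alpha B) = l (M - alpha) E = 0 and
   (A - alpha B) Q y = c P (M - alpha) y = 0. *)

Set Implicit Arguments.
Unset Strict Implicit.
Unset Printing Implicit Defensive.

Import Order.TTheory GRing.Theory Num.Theory.
Import numFieldNormedType.Exports.
Local Open Scope classical_set_scope.
Local Open Scope ring_scope.
Local Notation "A ^R" := (map_mx ratr A) (at level 2, format "A ^R").


(** * Laws of trajectories *)

Lemma traj_prob_rcons (R : realType) (X : finType)
    (K : seq (option X) -> option X -> R) h x :
  traj_prob K (rcons h x) = traj_prob K h * K h x.
Proof.
rewrite /traj_prob size_rcons big_ord_recr /=; congr (_ * _).
  apply: eq_bigr => i _.
  by rewrite -cats1 takel_cat 1?ltnW// nth_cat ltn_ord.
by rewrite -cats1 take_size_cat// nth_cat ltnn subnn.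
Qed.

Lemma sum_tuple_rcons (Y : finType) (V : nmodType) L (F : seq Y -> V) :
  \sum_(h : L.+1.-tuple Y) F h = \sum_(h : L.-tuple Y) \sum_x F (rcons h x).
Proof.
rewrite pair_bigA/=.
rewrite (reindex (fun p : L.-tuple Y * Y => [tuple of rcons p.1 p.2])) //=.
apply: onW_bij; apply: inj_card_bij.
  move=> [h x] [h' x'] /(congr1 val)/= /rcons_inj[hh xx].
  by congr pair => //; exact: val_inj.
by rewrite card_prod !card_tuple expnSr.
Qed.

Lemma measurable_cylinder (X : finType) (h : seq (option X)) :
  measurable (cylinder h : set (trajectory X)).
Proof. by apply: sub_sigma_algebra; exists h. Qed.

Section cylindrical.
Context (R : realType) (X : finType) (P : probability (trajectory X) R).
Context (p : seq (option X) -> R).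
Hypothesis P_cylinder : forall h, P (cylinder h) = (p h)%:E.
Variables (L : nat) (phi : seq (option X) -> R).

(** Exactly one cylinder of length [L] contains [w]. The resulting finite combination of indicators
    yields both measurability and the integral. *)
Lemma cylindricalE (w : trajectory X) :
  phi (mkseq w L) =
  \sum_(h : L.-tuple (option X)) phi h * \1_(cylinder (val h)) w.
Proof.
have [h0 h0E] : exists h0 : L.-tuple (option X), val h0 = mkseq w L.
  by exists (Tuple (introT eqP (size_mkseq w L))).
rewrite (bigD1 h0)//= big1 ?addr0 => [|h hh0].
  have h0w : cylinder (val h0) w by rewrite /cylinder /= size_tuple.
  by rewrite indicE mem_set// mulr1 -h0E.
rewrite indicE memNset ?mulr0// /cylinder/= size_tuple => hE.
by move/eqP: hh0; apply; apply: val_inj; rewrite h0E -[LHS]hE.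
Qed.

Lemma measurable_cylindrical :
  measurable_fun setT (fun w : trajectory X => phi (mkseq w L)).
Proof.
rewrite (funext cylindricalE).
apply: measurable_sum => h; apply: measurable_funM => //.
by apply: measurable_indic; exact: measurable_cylinder.
Qed.

Lemma integral_cylindrical :
  (\int[P]_w (phi (mkseq w L))%:E)%E =
  (\sum_(h : L.-tuple (option X)) p h * phi h)%:E.
Proof.
under eq_integral do rewrite cylindricalE -sumEFin.
have int1 (h : seq (option X)) :
    P.-integrable setT (fun w : trajectory X => (\1_(cylinder h) w)%:E).
  apply: integrable_indic => //; first exact: measurable_cylinder.
rewrite integral_sum//; last first.
  by move=> h; exact: (integrableZl measurableT (phi h) (int1 h)).
rewrite -sumEFin; apply: eq_bigr => h _.
under eq_integral do rewrite EFinM.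
rewrite integralZl// integral_indic//; last exact: measurable_cylinder.
by rewrite setIT EFinM [LHS]muleC; congr (_ * _)%E; exact: P_cylinder.
Qed.

End cylindrical.

Lemma cvg_mean (R : realType) (u : nat -> R) (l : R) :
  u @ \oo --> l -> (fun L => L%:R^-1 * \sum_(k < L) u k) @ \oo --> l.
Proof.
move=> /cesaro; rewrite /arithmetic_mean => ul.
(* The mean of index [n] in [cesaro] runs over the first [n + 1] terms, hence the shift by one. *)
rewrite -(cvg_shiftn 1); apply: cvg_trans ul.
apply: near_eq_cvg; near=> n.
by rewrite /= addn1 /series/= big_mkord.
Unshelve. all: by end_near.
Qed.

(** Capping the minimum at 1 covers an empty [I] and keeps [1 - c] nonnegative when [c] bounds
    absorption probabilities. *)
Lemma finite_lower_bound (R : realType) (I : finType) (f : I -> R) :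
  (forall i, 0 < f i) -> exists2 c, 0 < c <= 1 & forall i, c <= f i.
Proof.
move=> f0; exists (\big[Order.min/1]_i f i).
  by rewrite bigmin_le_id andbT; apply/bigmin_gtP; split.
by move=> i; exact: bigmin_le_cond.
Qed.

(** * Recursive halting games *)

Section absorption.
Context (R : realType) (m n : nat) (G : absorbing_game R m n).
Hypotheses (halting_G : halting G) (recursive_G : recursive G).
Local Notation stage := (option ('I_m * 'I_n * bool)).
Local Notation q := (absorption_prob G).
Local Notation w := (absorbing_payoff G).

(** The default 0 is the stage payoff of a recursive game, so this is also the payoff of the stage
    that follows [h]. *)
Definition terminal_payoff (h : seq stage) : R :=
  if absorbed_at h is Some a then w a else 0.

Lemma absorbed_at_rcons (h : seq stage) s :
  absorbed_at (rcons h s) =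
  match absorbed_at h, s with
  | None, Some (a, true) => Some a
  | x, _ => x
  end.
Proof.
rewrite /absorbed_at -cats1 pmap_cat filter_cat map_cat.
case: [seq s.1 | s <- pmap id h & s.2] => [|a t] /=; last by [].
by case: s => [[a []]|].
Qed.

(** One-step transition of the absorption status: an absorbed play keeps its status, any other one
    is absorbed at [a] with probability [q a] once [a] is played. *)
Lemma sum_stage_prob sigma tau h (psi : option ('I_m * 'I_n) -> R) :
  \sum_s stage_prob G sigma tau h s * psi (absorbed_at (rcons h s)) =
  if absorbed_at h is Some a then psi (Some a) else
  \sum_a sigma (played h) a.1 * tau (played h) a.2 *
    (q a * psi (Some a) + (1 - q a) * psi None).
Proof.
rewrite (bigD1 None)//= absorbed_at_rcons {1}/stage_prob.
case E : absorbed_at => [b|].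
  by rewrite mul1r big1 ?addr0// => -[s|//] _; rewrite /stage_prob E mul0r.
rewrite mul0r add0r (reindex_omap Some id) => [|[]//].
under eq_bigl => t do rewrite /= eqxx.
transitivity (\sum_(a : 'I_m * 'I_n) \sum_(b : bool)
  sigma (played h) a.1 * tau (played h) a.2 * (if b then q a else 1 - q a) *
  psi (if b then Some a else None)).
  rewrite pair_bigA; apply: eq_bigr => -[a b] _ /=.
  by rewrite absorbed_at_rcons E /stage_prob E; case: b.
by apply: eq_bigr => a _; rewrite big_bool/= -!mulrA -!mulrDr.
Qed.

Lemma payoff_at_recursive l om :
  payoff_at G l om = terminal_payoff (mkseq om l).
Proof.
rewrite /payoff_at /terminal_payoff.
by case: absorbed_at => // ; case: (om l) => // -[a _]; rewrite recursive_G.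
Qed.

Lemma absorbed_at_mkseq (om : nat -> stage) l k a : (l <= k)%N ->
  absorbed_at (mkseq om l) = Some a -> absorbed_at (mkseq om k) = Some a.
Proof.
move=> lk la; elim: k lk => [|k IH]; first by rewrite leqn0 => /eqP<-.
rewrite leq_eqVlt => /predU1P[<-//|]; rewrite ltnS => /IH ka.
by rewrite mkseqS absorbed_at_rcons ka.
Qed.

(** Along each trajectory the sequence is eventually constant: it stays at [w a] after absorption at
    [a], and at 0 if absorption never occurs. *)
Lemma cvg_terminal_payoff (om : trajectory ('I_m * 'I_n * bool)) :
  cvgn (fun l => terminal_payoff (mkseq om l)).
Proof.
have [[l]|none] := pselect (exists l, absorbed_at (mkseq om l)).
  case E : absorbed_at => [a|//] _.
  apply/cvg_ex; exists (w a); apply: cvg_near_cst; near=> k.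
  rewrite /terminal_payoff (@absorbed_at_mkseq om l k a)//.
  by near: k; exact: nbhs_infty_ge.
apply/cvg_ex; exists 0; apply: cvg_near_cst; near=> k.
rewrite /terminal_payoff; case E : absorbed_at => //.
by case: none; exists k; rewrite E.
Unshelve. all: by end_near.
Qed.

Lemma lim_mean_payoff om : limn_inf (mean_payoff G ^~ om) =
  limn (fun l => terminal_payoff (mkseq om l)).
Proof.
have /cvg_mean cmean := @cvg_terminal_payoff om.
have -> : mean_payoff G ^~ om =
    fun L => L%:R^-1 * \sum_(k < L) terminal_payoff (mkseq om k).
  apply/funext => L; rewrite /mean_payoff; congr (_ * _).
  by apply: eq_bigr => l _; exact: payoff_at_recursive.
exact: (cvg_limn_inf_sup cmean).1.
Qed.

Section balanced.
Context (sigma : strategy1 R m n) (tau : strategy2 R m n) (alpha : R).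
Hypothesis balanced : forall h, \sum_a sigma h a.1 * tau h a.2 *
  (q a * (w a - alpha)) = 0.
Local Notation K := (stage_prob G sigma tau).

(** The expectation of [psi] of the absorption status after [L] stages, as a finite sum over
    histories. *)
Let mean L (psi : option ('I_m * 'I_n) -> R) :=
  \sum_(h : L.-tuple stage) traj_prob K h * psi (absorbed_at h).

Let meanS L psi : mean L.+1 psi =
  \sum_(h : L.-tuple stage) traj_prob K h *
    if absorbed_at h is Some a then psi (Some a) else
    \sum_a sigma (played h) a.1 * tau (played h) a.2 *
    (q a * psi (Some a) + (1 - q a) * psi None).
Proof.
rewrite /mean (sum_tuple_rcons L
  (fun h : seq stage => traj_prob K h * psi (absorbed_at h))).
apply: eq_bigr => h _; rewrite -sum_stage_prob mulr_sumr.
by apply: eq_bigr => s _; rewrite traj_prob_rcons mulrA.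
Qed.

Let mean0 psi : mean 0 psi = psi None.
Proof.
rewrite /mean (big_pred1 [tuple]) => [|h]; last by apply/esym/eqP; exact: tuple0.
by rewrite /traj_prob big_ord0 mul1r.
Qed.

Let K_ge0 h s : 0 <= K h s. Proof. exact: stage_prob_ge0. Qed.

Let profile_sum1 h : \sum_a sigma h a.1 * tau h a.2 = 1.
Proof.
transitivity (\sum_(i : 'I_m) \sum_(j : 'I_n) sigma h i * tau h j).
  by rewrite [RHS]pair_bigA.
by rewrite -big_distrlr/= !Defs.pmf_sum1 mulr1.
Qed.

Let excess (o : option ('I_m * 'I_n)) : R := if o is Some a then w a - alpha else 0.

Let alive (o : option ('I_m * 'I_n)) : R := if o is Some a then 0 else 1.

(** The martingale property: absorbed histories keep their excess, and by [balanced] the others gain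
    0 on average at the next stage. *)
Let mean_excess L : mean L excess = 0.
Proof.
elim: L => [|L IH]; first by rewrite mean0.
rewrite meanS -[RHS]IH; apply: eq_bigr => h _; congr (_ * _).
case: absorbed_at => //=.
by under eq_bigr do rewrite mulr0 addr0; exact: balanced.
Qed.

Let mean_one L : mean L (fun=> 1) = 1.
Proof.
elim: L => [|L IH]; first by rewrite mean0.
rewrite meanS -[RHS]IH; apply: eq_bigr => h _; congr (_ * _).
case: absorbed_at => //=; rewrite -[RHS](profile_sum1 (played h)).
by apply: eq_bigr => a _; ring.
Qed.

Let mean_alive_ge0 L : 0 <= mean L alive.
Proof.
apply: sumr_ge0 => h _; apply: mulr_ge0; first by apply: prodr_ge0.
by case: absorbed_at.
Qed.

(** A play still alive is absorbed at the next stage with probability at least [c], so survival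
    decays geometrically. *)
Let mean_alive_le (c : R) L : (forall a, c <= q a) -> c <= 1 -> mean L alive <= (1 - c) ^+ L.
Proof.
move=> cq c1; elim: L => [|L IH]; first by rewrite mean0 expr0.
rewrite exprS meanS; apply: (@le_trans _ _ ((1 - c) * mean L alive)); last first.
  by rewrite ler_wpM2l ?subr_ge0.
rewrite /mean mulr_sumr; apply: ler_sum => h _.
rewrite mulrCA; apply: ler_wpM2l; first by apply: prodr_ge0.
case: absorbed_at => /= [_|]; first by rewrite mulr0.
rewrite mulr1 -[leRHS]mulr1 -[X in _ <= _ * X](profile_sum1 (played h)) mulr_sumr.
apply: ler_sum => a _; rewrite mulr0 add0r mulr1 [leRHS]mulrC.
apply: ler_wpM2l; first by rewrite mulr_ge0 ?Defs.pmf_ge0.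
by rewrite lerD2l lerN2.
Qed.

(** The expected terminal payoff after [L] stages is [alpha] times the probability of absorption,
    which tends to 1; dominated convergence passes to the limit. *)
Lemma average_payoff_balanced : average_payoff G sigma tau = alpha%:E.
Proof.
have [c /andP[c0 c1] cq] : exists2 c, 0 < c <= 1 & forall a, c <= q a.
  exact: finite_lower_bound.
pose Z L (om : trajectory ('I_m * 'I_n * bool)) := terminal_payoff (mkseq om L).
have EZ L : (\int[play_law G sigma tau]_om (Z L om)%:E)%E =
    (alpha * (1 - mean L alive))%:E.
  rewrite (integral_cylindrical (play_lawE G sigma tau)); congr EFin.
  (* Pointwise, the terminal payoff is [excess + alpha - alpha * alive], whether absorption has
     occurred or not. *)
  have -> : alpha * (1 - mean L alive) =
      mean L excess + (alpha * mean L (fun=> 1) - alpha * mean L alive).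
    by rewrite mean_excess mean_one; ring.
  rewrite /mean !mulr_sumr -sumrB -big_split/=.
  apply: eq_bigr => h _; rewrite /terminal_payoff /excess /alive.
  by case: absorbed_at => [a|]; ring.
rewrite /average_payoff unlock.
have ZE om : limn_inf (mean_payoff G ^~ om) = limn (Z ^~ om).
  exact: lim_mean_payoff.
under eq_integral do rewrite ZE.
have mZ L : measurable_fun setT (Z L) by exact: measurable_cylindrical.
have mlimZ : measurable_fun setT (fun om => limn (Z ^~ om)).
  by apply: (@measurable_fun_cvg _ _ _ _ Z) => // om _; exact: cvg_terminal_payoff.
pose W : R := \sum_a `|w a|.
have ZW L om : `|Z L om| <= W.
  rewrite /Z /terminal_payoff /W; case: absorbed_at => [a|].
    by rewrite (bigD1 a)//= lerDl; exact: sumr_ge0.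
  by rewrite normr0; exact: sumr_ge0.
have alive0 : mean ^~ alive @ \oo --> (0 : R).
  apply: (@squeeze_cvgr _ _ _ _ (cst 0) (fun L => (1 - c) ^+ L)).
  - by apply: nearW => L; rewrite mean_alive_ge0 mean_alive_le.
  - exact: cvg_cst.
  - by apply: cvg_expr; rewrite ger0_norm ?subr_ge0// ltrBlDr ltrDl.
have EZcvg : (fun L => (alpha * (1 - mean L alive))%:E) @ \oo --> alpha%:E.
  apply: cvg_EFin; first exact: nearW.
  have : alpha * (1 - mean L alive) @[L --> \oo] --> alpha * (1 - 0).
    by apply: cvgM; [exact: cvg_cst|apply: cvgB => //; exact: cvg_cst].
  by rewrite subr0 mulr1.
have [||||| _ _] := @dominated_convergence _ _ _ (play_law G sigma tau) setT
    measurableT (fun L om => (Z L om)%:E) (fun om => (limn (Z ^~ om))%:E)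
    (cst W%:E).
- by move=> L; exact/measurable_EFinP.
- exact/measurable_EFinP.
- apply: aeW => om _; apply: cvg_EFin; first exact: nearW.
  exact: cvg_terminal_payoff.
- exact: finite_measure_integrable_cst.
- by apply: aeW => om L _; rewrite lee_fin.
under eq_fun do rewrite EZ.
by move=> EZlim; exact: (cvg_unique _ EZlim EZcvg).
Qed.

End balanced.
End absorption.

(** Playing [x], respectively [y], at every stage makes the pair of strategies balanced against any
    opponent, so each player can force the payoff [alpha] exactly. *)
Lemma undiscounted_value_balanced (R : realType) (m n : nat)
    (G : absorbing_game R m n) (x : dist R 'I_m) (y : dist R 'I_n) (alpha : R) :
  halting G -> recursive G ->
  (forall j, \sum_i x i * (absorption_prob G (i, j) *
    (absorbing_payoff G (i, j) - alpha)) = 0) ->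
  (forall i, \sum_j y j * (absorption_prob G (i, j) *
    (absorbing_payoff G (i, j) - alpha)) = 0) ->
  undiscounted_value_is G alpha.
Proof.
move=> hG rG x0 y0; pose sx : strategy1 R m n := fun=> x.
pose ty : strategy2 R m n := fun=> y.
have sumE (F : 'I_m * 'I_n -> R) : \sum_a F a = \sum_i \sum_j F (i, j).
  by rewrite pair_bigA; apply: eq_bigr => -[].
have sxE tau : average_payoff G sx tau = alpha%:E.
  apply: average_payoff_balanced => // h.
  rewrite sumE exchange_big big1//= => j _.
  under eq_bigr do rewrite -mulrA mulrCA.
  by rewrite -mulr_sumr x0 mulr0.
have tyE sigma : average_payoff G sigma ty = alpha%:E.
  apply: average_payoff_balanced => // h.
  rewrite sumE big1//= => i _.
  under eq_bigr do rewrite -mulrA.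
  by rewrite -mulr_sumr y0 mulr0.
split; apply/eqP; rewrite eq_le; apply/andP; split.
- apply: ge_ereal_sup => _ [sigma _ <-].
  by apply: ereal_inf_lbound; exists ty.
- apply: le_trans (ereal_sup_ubound _); last by exists sx.
  by apply: le_ereal_inf_tmp => _ [tau _ <-]; rewrite sxE.
- apply: le_trans (ereal_inf_lbound _) _; first by exists ty.
  by apply: ge_ereal_sup => _ [sigma _ <-]; rewrite tyE.
- apply: le_ereal_inf_tmp => _ [tau _ <-].
  by apply: ereal_sup_ubound; exists sx.
Qed.

(** * Games built from matrix pencils *)

Lemma normalized_sum1 (R : realType) (I : finType) (x : I -> R) :
  0 < \sum_i x i -> \sum_i (x i / \sum_k x k) = 1.
Proof. by move=> s0; rewrite -mulr_suml divff// gt_eqF. Qed.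

Lemma normalized_ge0 (R : realType) (I : finType) (x : I -> R) i :
  (forall i, 0 <= x i) -> 0 <= x i / \sum_k x k.
Proof. by move=> x0; rewrite divr_ge0// sumr_ge0. Qed.

Definition normalize (R : realType) (I : finType) (x : I -> R)
    (x0 : forall i, 0 <= x i) (sx : 0 < \sum_i x i) : dist R I :=
  Dist (fun i => normalized_ge0 i x0) (normalized_sum1 sx).

Lemma game_of_pencil (R : realType) (m n : nat) (A B : 'M[rat]_(m, n))
    (x : 'rV[R]_m) (y : 'cV[R]_n) (alpha : R) :
  (0 < m)%N -> (0 < n)%N ->
  (forall i j, 0 < B i j) -> (forall i, 0 < x 0 i) -> (forall j, 0 < y j 0) ->
  x *m A^R = alpha *: (x *m B^R) -> A^R *m y = alpha *: (B^R *m y) ->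
  exists G : absorbing_game R m n,
    [/\ rational_game G, halting G, recursive G,
        undiscounted_value_is G alpha &
        ((forall i j, 0 < A i j) -> positive_recursive G)].
Proof.
move=> m0 n0 B0 x0 y0 xAB ABy.
pose i0 := Ordinal m0; pose j0 := Ordinal n0.
(* Dividing [B] by the sum of its entries gives rational probabilities; then [q (w - alpha)] is
   [A - alpha B] up to the factor [1 / S]. *)
pose S := \sum_(a : 'I_m * 'I_n) B a.1 a.2.
have BS a : B a.1 a.2 <= S.
  by rewrite /S (bigD1 a)//= lerDl sumr_ge0// => ? _; exact: ltW.
have S0 : 0 < S := lt_le_trans (B0 i0 j0) (BS (i0, j0)).
pose q a : R := ratr (B a.1 a.2 / S).
pose w a : R := ratr (A a.1 a.2 / B a.1 a.2).
have q01 a : 0 <= q a <= 1.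
  rewrite /q -(rmorph1 (@ratr R)) ler_rat ler0q divr_ge0 ?(ltW (B0 _ _)) ?(ltW S0)//=.
  by rewrite ler_pdivrMr// mul1r.
have qwE i j : q (i, j) * (w (i, j) - alpha) =
    (A^R i j - alpha * B^R i j) / ratr S.
  rewrite /q /w !mxE/= !fmorph_div/=.
  have SN0 : ratr S != 0 :> R by rewrite fmorph_eq0 gt_eqF.
  have BN0 : ratr (B i j) != 0 :> R by rewrite fmorph_eq0 gt_eqF.
  by field; rewrite SN0 BN0.
pose G : absorbing_game R m n := AbsorbingGame (fun=> 0) w q01.
have rG : recursive G by [].
have hG : halting G by move=> a; rewrite /= /q ltr0q divr_gt0.
exists G; split => //.
- by move=> a; split; [exists 0; rewrite ?rmorph0|eexists|eexists].
- have sx : 0 < \sum_i x 0 i.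
    by rewrite (bigD1 i0)//= ltr_pwDl// sumr_ge0// => i _; exact: ltW.
  have sy : 0 < \sum_j y j 0.
    by rewrite (bigD1 j0)//= ltr_pwDl// sumr_ge0// => i _; exact: ltW.
  apply: (@undiscounted_value_balanced _ _ _ G (normalize (fun i => ltW (x0 i)) sx)
    (normalize (fun j => ltW (y0 j)) sy)) => //= [j|i].
    transitivity (((x *m A^R) 0 j - alpha * (x *m B^R) 0 j) /
        (ratr S * \sum_i x 0 i)).
      rewrite !mxE mulr_sumr -sumrB mulr_suml; apply: eq_bigr => i _.
      by rewrite qwE !mxE [X in _ = _ * X]invfM; ring.
    by rewrite xAB mxE subrr mul0r.
  transitivity (((A^R *m y) i 0 - alpha * (B^R *m y) i 0) /
      (ratr S * \sum_i y i 0)).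
    rewrite !mxE mulr_sumr -sumrB mulr_suml; apply: eq_bigr => j _.
    by rewrite qwE !mxE [X in _ = _ * X]invfM; ring.
  by rewrite ABy mxE subrr mul0r.
- by move=> A0; split => // a _ /=; rewrite /w ltr0q divr_gt0.
Qed.

(** * Rational simplicial cones *)

(** The rows are [r] shifted by [e] along each coordinate axis. A scalar matrix plus a rank-one
    matrix is easy to invert explicitly. *)
Definition simplex_mx (F : comPzRingType) (m : nat) (r : 'rV[F]_m) (e : F) : 'M[F]_m :=
  const_mx 1 *m r + e%:M.

Lemma simplex_mxE (F : comPzRingType) (m : nat) (r : 'rV[F]_m) (e : F) i j :
  simplex_mx r e i j = r 0 j + e *+ (i == j).
Proof. by rewrite !mxE big_ord1 !mxE mul1r. Qed.

Lemma mul_rV_simplex_mx (F : comPzRingType) (m : nat) (x r : 'rV[F]_m) (e : F) j :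
  (x *m simplex_mx r e) 0 j = (\sum_i x 0 i) * r 0 j + x 0 j * e.
Proof.
rewrite mulmxDr mul_mx_scalar mulmxA !mxE big_ord1 !mxE mulrC [in X in _ + X]mulrC.
by rewrite mulrC; congr (_ * _ + _); apply: eq_bigr => i _; rewrite mxE mulr1.
Qed.

(** The Sherman-Morrison inverse, with denominators cleared. *)
Lemma mul_simplex_mx (F : comPzRingType) (m : nat) (r : 'rV[F]_m) (e : F) :
  ((e + \sum_j r 0 j)%:M - const_mx 1 *m r) *m simplex_mx r e =
  ((e + \sum_j r 0 j) * e)%:M.
Proof.
have r1 : r *m const_mx 1 = (\sum_j r 0 j)%:M :> 'M[F]_1.
  rewrite [RHS]mx11_scalar [LHS]mx11_scalar !mxE/= mulr1n; congr scalar_mx.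
  by apply: eq_bigr => j _; rewrite mxE mulr1.
rewrite /simplex_mx mulmxDr mulmxBl mulmxBl.
rewrite -mulmxA (mulmxA r) r1 !mul_scalar_mx !mul_mx_scalar scale_scalar_mx.
rewrite -scalemxAr addrCA -[RHS]addr0; congr (_ + _).
by rewrite -!scalerBl addrK subrr scale0r.
Qed.

(** Rows close to [l] inherit the positivity of [l N]. The bounds on [r] and on the sum of [l] place
    [l] in the interior of the cone spanned by the rows. *)
Lemma nearby_simplex (R : realType) (m k : nat) (l : 'rV[R]_m) (N : 'M[R]_(m, k)) :
  (forall j, 0 < l 0 j) -> (forall j, 0 < (l *m N) 0 j) ->
  exists (r : 'rV[rat]_m) (e : rat),
    [/\ forall j, 0 < (ratr (r 0 j) : R) < l 0 j, 0 < e,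
        \sum_j l 0 j < ratr (e + \sum_j r 0 j) &
        forall i j, 0 < ((simplex_mx r e)^R *m N) i j].
Proof.
move=> l0 lN0.
have [c /andP[c0 _] cN] := finite_lower_bound lN0.
pose C := 1 + \sum_i \sum_j `|N i j|.
have C1 : 1 <= C by rewrite /C lerDl sumr_ge0// => i _; exact: sumr_ge0.
have NC i j : `|N i j| <= C.
  rewrite /C (bigD1 i)//= (bigD1 j)//=.
  have S1 := @sumr_ge0 R _ (index_enum 'I_k) (fun i0 => i0 != j)
    (fun i0 => `|N i i0|) (fun _ _ => normr_ge0 _).
  have S2 : 0 <= \sum_(i0 | i0 != i) \sum_i1 `|N i0 i1|.
    by apply: sumr_ge0 => ? _; exact: sumr_ge0.
  by lra.
(* Thus [c = (2m + 2) d C]. Replacing [l] by [r] costs at most [m d C] and the shift by [e] at most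
   [(m + 1) d C], in total less than [c]. *)
pose d := c / (C * m.+1.*2%:R).
have d0 : 0 < d by rewrite divr_gt0// mulr_gt0// (lt_le_trans ltr01).
have rP j : exists q : rat, Num.max 0 (l 0 j - d) < ratr q < l 0 j.
  have /rat_in_itvoo[q] : Num.max 0 (l 0 j - d) < l 0 j.
    by rewrite gt_max l0 ltrBlDr ltrDl.
  by rewrite in_itv/=; exists q.
have [r rlt] := choice rP.
(* The lower bound makes [e] exceed the sum of the [l_j - r_j], each at most [d]; the upper bound
   limits the perturbation. *)
have [e] : exists e : rat, m%:R * d < ratr e < m.+1%:R * d.
  have /rat_in_itvoo[q] : m%:R * d < m.+1%:R * d by rewrite ltr_pM2r// ltr_nat.
  by rewrite in_itv/=; exists q.
move=> /andP[me em].
have e0 : 0 < ratr e :> R by rewrite (le_lt_trans _ me)// mulr_ge0// ltW.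
have rl j : 0 < (ratr (r j) : R) < l 0 j.
  by have := rlt j; rewrite gt_max => /andP[/andP[-> _] ->].
have lr j : 0 <= l 0 j - ratr (r j) <= d.
  have := rlt j; rewrite gt_max => /andP[/andP[_ a] b].
  by rewrite subr_ge0 ltW//= lerBlDl -lerBlDr ltW.
exists (\row_j r j), e; split => [j|||i j]; rewrite ?mxE//.
- by rewrite ltr0q in e0.
- rewrite rmorphD rmorph_sum/= -ltrBlDr -sumrB; apply: le_lt_trans me.
  rewrite mulr_natl -[X in _ *+ X]card_ord -sumr_const; apply: ler_sum => j _.
  by rewrite mxE; case/andP: (lr j).
have -> : \sum_j0 (simplex_mx (\row_j r j) e)^R i j0 * N j0 j =
    (l *m N) 0 j - \sum_p (l 0 p - ratr (r p)) * N p j + ratr e * N i j.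
  rewrite mxE -sumrB.
  under eq_bigr => p _ do rewrite mxE simplex_mxE mxE rmorphD mulrDl/=.
  rewrite big_split/=; congr (_ + _).
    by apply: eq_bigr => p _; ring.
  rewrite (bigD1 i)//= eqxx big1 ?addr0// => p /negPf.
  by rewrite eq_sym => ->; rewrite rmorph0 mul0r.
have h1 : \sum_p (l 0 p - ratr (r p)) * N p j <= m%:R * (d * C).
  rewrite mulr_natl -[X in _ *+ X]card_ord -sumr_const; apply: ler_sum => p _.
  have /andP[a b] := lr p.
  apply: (le_trans (ler_norm _)); rewrite normrM (ger0_norm a).
  by apply: ler_pM.
have h2 : - (ratr e * N i j) <= m.+1%:R * (d * C).
  apply: (le_trans (ler_norm _)); rewrite normrN normrM (ger0_norm (ltW e0)) mulrA.
  by apply: ler_pM => //; [exact: ltW|exact: ltW].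
have h3 : (m%:R + m.+1%:R) * (d * C) < (l *m N) 0 j.
  apply: lt_le_trans (cN j).
  have -> : c = m.+1.*2%:R * (d * C).
    rewrite /d; field; rewrite -muln2 pnatr_eq0 muln2 double_eq0/=.
    by rewrite gt_eqF// (lt_le_trans ltr01).
  rewrite ltr_pM2r; last by rewrite mulr_gt0// (lt_le_trans ltr01).
  by rewrite -natrD ltr_nat -addnn addSn.
by rewrite mulrDl in h3; lra.
Qed.

(** * Pencils with positive kernel vectors *)

Lemma pencil_of_eigenvectors (R : realType) (m : nat) (M : 'M[rat]_m)
    (l : 'rV[R]_m) (y : 'cV[R]_m) (alpha : R) :
  (forall j, 0 < l 0 j) -> 0 < (l *m y) 0 0 ->
  l *m M^R = alpha *: l -> M^R *m y = alpha *: y ->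
  exists (A B : 'M[rat]_m) (x : 'rV[R]_m) (z : 'cV[R]_m),
    [/\ forall i j, 0 < B i j, 0 < alpha -> forall i j, 0 < A i j,
        (forall i, 0 < x 0 i) /\ (forall j, 0 < z j 0),
        x *m A^R = alpha *: (x *m B^R) & A^R *m z = alpha *: (B^R *m z)].
Proof.
move=> l0 ly0 lM My.
have l1 : 0 <= \sum_j l 0 j by rewrite sumr_ge0// => j _; exact: ltW.
(* [Q] comes first, since how close [P] must be to [l] depends on [E], hence on [Q]. *)
have [|r [e [rl e0 lr Qy0]]] := @nearby_simplex _ _ _ l y l0.
  by move=> j; rewrite ord1.
pose Q := simplex_mx r e; pose t := e + \sum_j r 0 j.
pose E := t%:M - const_mx 1 *m r.
have EQ : E *m Q = (t * e)%:M by exact: mul_simplex_mx.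
have lE0 j : 0 < (l *m E^R) 0 j.
  have -> : (l *m E^R) 0 j = ratr t * l 0 j - (\sum_i l 0 i) * ratr (r 0 j).
    rewrite map_mxB map_scalar_mx map_mxM map_const_mx rmorph1 mulmxBr.
    rewrite mul_mx_scalar mulmxA !mxE big_ord1 !mxE; congr (_ - _ * _).
    by apply: eq_bigr => i _; rewrite mxE mulr1.
  have /andP[r0 rlj] := rl j.
  (* Both factors increase: [r] lies below [l], and the sum of [l] below [t]. *)
  rewrite subr_gt0; apply: (@le_lt_trans _ _ ((\sum_i l 0 i) * l 0 j)).
    by rewrite ler_wpM2l// ltW.
  by rewrite ltr_pM2r.
have lME : l *m (M *m E)^R = alpha *: (l *m E^R).
  by rewrite map_mxM mulmxA lM scalemxAl.
(* Side by side blocks let a single [P] serve both [B] and [A]. Unless [alpha > 0], [l M E] is not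
   positive and the second block just repeats [E]. *)
pose N : 'M[R]_(m, m + m) := row_mx E^R (if 0 < alpha then (M *m E)^R else E^R).
have [|p [f [pl f0 lp PN0]]] := @nearby_simplex _ _ _ l N l0.
  move=> j; rewrite mul_mx_row mxE; case: splitP => k _ //.
  by case: ifPn => // a0; rewrite lME mxE mulr_gt0.
pose P := simplex_mx p f.
(* Summing the coordinates of [x P = l] shows that [s] must be the sum of [x], which then determines
   [x]; [s < 1] will give [x > 0]. *)
pose s : R := (\sum_j l 0 j) / ratr (f + \sum_j p 0 j).
have u0 : 0 < ratr (f + \sum_j p 0 j) :> R by exact: le_lt_trans lp.
pose x := \row_j ((l 0 j - s * ratr (p 0 j)) / ratr f).
have fR0 : 0 < ratr f :> R by rewrite ltr0q.
have x0 j : 0 < x 0 j.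
  have /andP[p0 plj] := pl j.
  rewrite mxE divr_gt0// subr_gt0; apply: lt_trans plj.
  by rewrite gtr_pMl// ltr_pdivrMr// mul1r.
have sx : \sum_j x 0 j = s.
  have -> : \sum_j x 0 j = (\sum_j l 0 j - s * \sum_j ratr (p 0 j)) / ratr f.
    rewrite mulr_sumr -sumrB mulr_suml; apply: eq_bigr => j _.
    by rewrite mxE.
  have -> : \sum_j l 0 j = s * ratr (f + \sum_j p 0 j).
    by rewrite divfK// gt_eqF.
  by rewrite rmorphD rmorph_sum/= -mulrBr addrK mulfK// gt_eqF.
have xP : x *m P^R = l.
  apply/rowP => j.
  have -> : P^R = simplex_mx (p^R) (ratr f) :> 'M[R]_m.
    by rewrite /P /simplex_mx map_mxD map_mxM map_const_mx rmorph1 map_scalar_mx.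
  rewrite mul_rV_simplex_mx sx !mxE divfK ?gt_eqF//; ring.
have te0 : 0 < t * e.
  by rewrite mulr_gt0// -(ltr0q R) (le_lt_trans l1).
exists (P *m M *m E), (P *m E), x, (Q^R *m y); split.
- move=> i j; have := PN0 i (lshift m j).
  by rewrite mul_mx_row row_mxEl -map_mxM mxE ltr0q.
- move=> a0 i j; have := PN0 i (rshift m j).
  by rewrite mul_mx_row row_mxEr a0 -map_mxM mulmxA mxE ltr0q.
- by split=> // j; exact: Qy0.
- by rewrite !map_mxM !mulmxA xP lM -scalemxAl.
- have EQy : E^R *m (Q^R *m y) = ratr (t * e) *: y.
    by rewrite mulmxA -map_mxM EQ map_scalar_mx mul_scalar_mx.
  rewrite !map_mxM -!mulmxA EQy -!scalemxAr My -!scalemxAr.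
  by rewrite !scalerA mulrC.
Qed.

(** * Companion matrices *)

Lemma sum_ord_eq (V : pzSemiRingType) n (F : nat -> V) k :
  \sum_(i < n) F i * (i == k :> nat)%:R = if (k < n)%N then F k else 0.
Proof.
case: ifPn => kn.
  rewrite (bigD1 (Ordinal kn))//= eqxx mulr1 big1 ?addr0// => i.
  by rewrite -val_eqE/= => /negPf->; rewrite mulr0.
rewrite big1// => i _; case: eqP => [ik|]; last by rewrite mulr0.
by rewrite -ik ltn_ord in kn.
Qed.

Section horner_coefficients.
Context (R : realType) (p : {poly rat}) (alpha : R).
Hypothesis p_root : root (map_poly ratr p) alpha.

(** The intermediate values of Horner's scheme at [alpha], which are the coefficients of the
    quotient of [p] by [X - alpha]. *)
Definition horner_coef j : R := (map_poly ratr (drop_poly j.+1 p)).[alpha].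

Lemma horner_drop_poly j :
  (map_poly ratr (drop_poly j p)).[alpha] = horner_coef j * alpha + ratr p`_j.
Proof.
have -> : drop_poly j p = drop_poly j.+1 p * 'X + (p`_j)%:P.
  apply/polyP => i; rewrite coefD coefMX coefC !coef_drop_poly.
  by case: i => [|i]; rewrite /= ?add0r ?add0n// addr0 addSnnS.
by rewrite rmorphD rmorphM/= map_polyX map_polyC !hornerE.
Qed.

Lemma horner_coef0 : horner_coef 0 * alpha = - ratr p`_0.
Proof.
apply/eqP; rewrite -addr_eq0 -horner_drop_poly.
have -> : drop_poly 0 p = p by apply/polyP => i; rewrite coef_drop_poly addn0.
exact: p_root.
Qed.

Lemma horner_coefS j : horner_coef j = horner_coef j.+1 * alpha + ratr p`_j.+1.
Proof. exact: horner_drop_poly. Qed.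

Lemma horner_coef_oversize j : (size p <= j.+1)%N -> horner_coef j = 0.
Proof. by move=> pj; rewrite /horner_coef drop_poly_eq0// rmorph0 horner0. Qed.

(** Differentiating [p = L (X - alpha)] and evaluating at [alpha] leaves [L(alpha)]. *)
Lemma sum_horner_coef n : (size p <= n.+1)%N ->
  \sum_(j < n) horner_coef j * alpha ^+ j = (map_poly ratr p^`()).[alpha].
Proof.
move=> pn; pose L := \poly_(j < n) horner_coef j.
have Lj j : L`_j = horner_coef j.
  rewrite coef_poly; case: ltnP => // nj.
  by rewrite horner_coef_oversize// (leq_trans pn).
have -> : map_poly ratr p^`() = (map_poly ratr p : {poly R})^`() by rewrite deriv_map.
have -> : map_poly ratr p = L * ('X - alpha%:P) :> {poly R}.
  apply/polyP => i; rewrite coef_map mulrBr coefB coefMX coefMC !Lj/=.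
  case: i => [|i] /=; first by rewrite horner_coef0 sub0r opprK.
  by rewrite [horner_coef i]horner_coefS addrC addKr.
rewrite derivM derivB derivX derivC subr0 mulr1 hornerD hornerM !hornerE subrr.
by rewrite mulr0 add0r horner_poly.
Qed.

End horner_coefficients.

Lemma eigenvectors_of_algebraic (R : realType) (n : nat) (alpha : R) :
  algebraic_of_degree alpha n.+1 ->
  exists (M : 'M[rat]_n.+1) (l : 'rV[R]_n.+1) (y : 'cV[R]_n.+1),
    [/\ forall j, 0 < l 0 j, 0 < (l *m y) 0 0,
        l *m M^R = alpha *: l & M^R *m y = alpha *: y].
Proof.
move=> [[p [sp pa]] min_p].
pose h := horner_coef p alpha.
(* [h j] is the value at [alpha] of a nonzero rational polynomial of degree at most [n]; so is
   [p'(alpha)] below. *)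
have h0 j : (j < n.+1)%N -> h j != 0.
  move=> jn; have /= := min_p (drop_poly j.+1 p).
  rewrite -size_poly_gt0 size_drop_poly sp subn_gt0 => /(_ jn).
  by rewrite subSS; apply; exact: leq_subr.
have p'0 : (map_poly ratr p^`()).[alpha] != 0.
  apply: (min_p p^`()).
    apply/eqP => /(congr1 (fun u : {poly rat} => u`_n)).
    rewrite coef_deriv coef0 => /eqP; rewrite mulrn_eq0/=.
    have -> : p`_n.+1 = lead_coef p by rewrite lead_coefE sp.
    by rewrite lead_coef_eq0 -size_poly_eq0 sp.
  by rewrite -ltnS -sp; apply: lt_size_deriv; rewrite -size_poly_eq0 sp.
have sumh : \sum_(j < n.+1) h j * alpha ^+ j = (map_poly ratr p^`()).[alpha].
  by apply: sum_horner_coef => //; rewrite sp.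
have hn : h n = ratr p`_n.+1.
  by rewrite /h horner_coefS (@horner_coef_oversize _ _ _ n.+1) ?sp// mul0r add0r.
have lc0 : ratr p`_n.+1 != 0 :> R by rewrite -hn h0.
(* Companion matrix with ones above the diagonal and the coefficients in the last row: [h] is a left
   eigenvector, the powers of [alpha] a right one. *)
pose C i j : rat := (i.+1 == j)%:R - (i == n)%:R * (p`_j / p`_n.+1).
have CE i j : ratr (C i j) = (i.+1 == j)%:R - (i == n)%:R * (ratr p`_j / h n).
  by rewrite hn rmorphB rmorphM !rmorph_nat fmorph_div.
have hC (j : 'I_n.+1) : \sum_(i < n.+1) h i * ratr (C i j) = alpha * h j.
  under eq_bigr do rewrite CE mulrBr (mulrA (h _)).
  rewrite sumrB -mulr_suml sum_ord_eq ltnSn mulrCA divff ?h0// mulr1.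
  case: j => -[|j] jn/=.
    rewrite big1 => [|i _]; last by rewrite mulr0.
    by rewrite sub0r [RHS]mulrC horner_coef0.
  under eq_bigr do rewrite eqSS.
  by rewrite sum_ord_eq ltnW// /h horner_coefS mulrC addrK.
have Ca (i : 'I_n.+1) : \sum_(j < n.+1) ratr (C i j) * alpha ^+ j = alpha * alpha ^+ i.
  under eq_bigr => j _ do rewrite CE mulrBl -mulrA [_%:R * alpha ^+ j]mulrC eq_sym.
  rewrite sumrB sum_ord_eq -mulr_sumr ltnS.
  have := ltn_ord i; rewrite ltnS leq_eqVlt => /predU1P[->|iltn].
    rewrite ltnn eqxx mul1r sub0r.
    have -> : \sum_(j < n.+1) ratr p`_j / h n * alpha ^+ j =
        (map_poly ratr p).[alpha] / h n - alpha ^+ n.+1.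
      rewrite (@horner_coef_wide _ n.+2) ?size_map_poly ?sp// [in RHS]big_ord_recr/=.
      rewrite coef_map/= -hn mulrDl [h n * _]mulrC mulfK ?h0// addrK mulr_suml.
      by apply: eq_bigr => j _; rewrite coef_map mulrAC.
    by rewrite (rootP pa) mul0r sub0r opprK exprS.
  by rewrite iltn (ltn_eqF iltn) mul0r subr0 exprS.
(* Conjugation by the diagonal sign matrix [d] makes the left eigenvector positive and preserves the
   pairing; the sign [s] then turns the pairing into the absolute value of [p'(alpha)]. *)
pose d j : rat := if 0 < h j then 1 else -1.
have dd j : d j * d j = 1 by rewrite /d; case: ifP => _; rewrite ?mulrNN mulr1.
have ddR j : ratr (d j) * ratr (d j) = 1 :> R by rewrite -rmorphM dd rmorph1.
pose s : R := Num.sg (map_poly ratr p^`()).[alpha].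
pose l : 'rV[R]_n.+1 := \row_j (ratr (d j) * h j).
pose y : 'cV[R]_n.+1 := \col_j (s * (ratr (d j) * alpha ^+ j)).
exists (\matrix_(i, j) (d i * C i j * d j)), l, y; split.
- move=> j; rewrite mxE /d; case: ifPn => [hj|]; first by rewrite rmorph1 mul1r.
  rewrite -leNgt le_eqVlt (negPf (h0 j (ltn_ord j)))/= => hj.
  by rewrite rmorphN rmorph1 mulN1r oppr_gt0.
- suff -> : (l *m y) 0 0 = `|(map_poly ratr p^`()).[alpha]| by rewrite normr_gt0.
  rewrite normrEsg -/s -sumh mxE mulr_sumr; apply: eq_bigr => j _; rewrite !mxE.
  by rewrite -[RHS]mul1r -(ddR j); ring.
- apply/rowP => j; rewrite !mxE mulrCA -hC mulr_sumr; apply: eq_bigr => i _.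
  by rewrite !mxE !rmorphM/= -[RHS]mul1r -(ddR i); ring.
- apply/colP => i; rewrite !mxE.
  transitivity (s * (ratr (d i) * (alpha * alpha ^+ i))); last by ring.
  rewrite -Ca !mulr_sumr; apply: eq_bigr => j _.
  by rewrite !mxE !rmorphM/= -[RHS]mul1r -(ddR j); ring.
Qed.

Theorem theorem1 (R : realType) (m : nat) (alpha : R) :
  (1 <= m)%N -> algebraic_of_degree alpha m ->
  exists G : absorbing_game R m m,
    [/\ rational_game G, halting G, recursive G,
        undiscounted_value_is G alpha &
        (0 < alpha -> positive_recursive G)].
Proof.
case: m => [//|n] n0 /eigenvectors_of_algebraic[M [l [y [l0 ly0 lM My]]]].
have [A [B [x [z [B0 A0 [x0 z0] xAB ABz]]]]] :=
  pencil_of_eigenvectors l0 ly0 lM My.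
have [G [ratG hG rG vG pG]] := game_of_pencil n0 n0 B0 x0 z0 xAB ABz.
by exists G; split=> // /A0/pG.
Qed.
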